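(* Consider a finite irreducible Markov renewal process with state space $S=\{1,\dots,m\}$, embedded chain transition matrix $P$ with stationary probability vector $\pi$, mean sojourn time vector $\mu$, $\lambda=\pi^T\mu>0$, mean first passage times $m_{ij}$, and stationary probability vector $\varpi$ of the associated semi-Markov process. Let $k^{(2)}=(k^{(2)}_1,\dots,k^{(2)}_m)^T$ with $k_i^{(2)}=\sum_{j=1}^m \varpi_j m_{ij}$. Then: (a) If $G$ is any g-inverse of $I-P$, then $$k^{(2)}=\left[I+EG_d-\tfrac1\lambda E(G\mu\pi^T)_d\right]\mu.$$ (b) If $Z=[I-P+\Pi]^{-1}$, then $$k^{(2)}=\left[I+EZ_d-\tfrac1\lambda E(Z\mu\pi^T)_d\right]\mu.$$ (c) If $A^{\#}$ is the group inverse of $I-P$, then $$k^{(2)}=\left[I+EA^{\#}_d-\tfrac1\lambda E(A^{\#}\mu\pi^T)_d\right]\mu.$$ (d) If $\widetilde G=[I-P+\mu u^T]^{-1}$, where $u\in\mathbb{R}^m$ satisfies $u^Te\neq0$, then $$k^{(2)}=\mu-\frac{1}{u^Te}\,e+\left(e^T\widetilde G_d\,\mu\right)e.$$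
   Context: A Markov renewal process (MRP) $\{(X_n,T_n),n\ge 0\}$ on $S=\{1,\dots,m\}$ has $T_0=0\le T_1\le T_2\le\cdots$ and semi-Markov kernel $Q_{ij}(t)=P\{X_{n+1}=j,\ T_{n+1}-T_n\le t\mid X_n=i\}$ (Markov property: conditionally on the past up to step $n$, the law of $(X_{n+1},T_{n+1}-T_n)$ depends only on $X_n$, through this kernel). The embedded Markov chain $\{X_n\}$ has transition matrix $P=[p_{ij}]$, $p_{ij}=Q_{ij}(+\infty)$; the MRP is called irreducible when $P$ is irreducible. Put $\mu_{ij}=\int_0^\infty t\,dQ_{ij}(t)$, assumed finite, and $\mu_i=\sum_k\mu_{ik}$, the mean sojourn time on a visit to state $i$; $\mu=(\mu_1,\dots,\mu_m)^T$. $\pi=(\pi_1,\dots,\pi_m)^T$ is the unique vector with $\pi^TP=\pi^T$, $\pi^Te=1$, where $e=(1,\dots,1)^T$; $\Pi=e\pi^T$, $E=ee^T$. $\lambda=\pi^T\mu$, assumed positive. The associated semi-Markov process is $X(t)=X_n$ for $T_n\le t<T_{n+1}$; its stationary probability vector $\varpi$ is given by $\varpi_j=\pi_j\mu_j/\lambda$. The mean first passage time is $m_{ij}=E[T_{ij}\mid X_0=i]$, where $T_{ij}=T_n$ with $n=\min\{r\ge1: X_r=j\}$ given $X_0=i$ (the return time if $i=j$); these are all finite. For a square matrix $X$, $X_d$ is the diagonal matrix with the same diagonal as $X$. A g-inverse (one-condition generalized inverse) of $I-P$ is any matrix $G$ with $(I-P)G(I-P)=I-P$. The group inverse $A^{\#}$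 of $A=I-P$ is the unique matrix with $AA^{\#}A=A$, $A^{\#}AA^{\#}=A^{\#}$, $AA^{\#}=A^{\#}A$; it equals $Z-\Pi$. *)

(* Defs.v *)
From HB Require Import structures.
From mathcomp Require Import all_boot all_order all_algebra.
From mathcomp Require Import all_classical all_reals all_analysis.

Set Implicit Arguments.
Unset Strict Implicit.
Unset Printing Implicit Defensive.

Import Order.TTheory GRing.Theory Num.Theory.
Import numFieldNormedType.Exports.

Local Open Scope classical_set_scope.
Local Open Scope ring_scope.

Section Matrices.
Context {R : realType} {m : nat}.

Definition evec : 'cV[R]_m := const_mx 1.

Definition Emx : 'M[R]_m := evec *m evec^T.

Definition diagpart (A : 'M[R]_m) : 'M[R]_m := diag_mx (\row_j A j j).

Definition irreducible_mx (P : 'M[R]_m) : Prop :=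
  forall i j : 'I_m, exists n : nat, 0 < (P ^+ n) i j.

Definition is_ginverse (A G : 'M[R]_m) : Prop := A *m G *m A = A.

Definition is_group_inverse (A H : 'M[R]_m) : Prop :=
  [/\ A *m H *m A = A, H *m A *m H = H & A *m H = H *m A].

End Matrices.

Section SemiMarkovKernel.
Context {R : realType} {m : nat}.

(* [Q i j] is nondecreasing and right-continuous, being the (defective)
   distribution function of a sojourn time, so it is taken in [cumulative R R];
   this makes its Stieltjes measure available. That [Q] is substochastic and
   vanishes on the negative reals follows from [is_MRP] below. *)
Variable Q : 'I_m -> 'I_m -> cumulative R R.

Definition embedded_mx : 'M[R]_m :=
  \matrix_(i, j) lim (Q i j t @[t --> +oo]).

Definition mean_time (i j : 'I_m) : \bar R :=
  (\int[lebesgue_stieltjes_measure (Q i j)]_(t in `[0%R, +oo[) t%:E)%E.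

(* Real-valued; meaningful when every [mean_time i j] is finite. *)
Definition mean_sojourn : 'cV[R]_m := \col_i \sum_(k < m) fine (mean_time i k).

End SemiMarkovKernel.

Section MarkovRenewalProcess.
Context {d : measure_display} {Omega : measurableType d} {R : realType}.
Context {m : nat}.
Variables (X : nat -> Omega -> 'I_m) (T : nat -> Omega -> R).

(* The sigma-algebra generated by X_0, T_0, ..., X_n, T_n. *)
Definition past (n : nat) : set (set Omega) :=
  <<s \bigcup_(k in [set k | (k <= n)%N])
        (preimage_set_system setT (X k) setT `|`
         preimage_set_system setT (T k) measurable) >>.

Definition jump (n : nat) (i j : 'I_m) (t : R) : set Omega :=
  [set w | [/\ X n w = i, X n.+1 w = j & T n.+1 w - T n w <= t]].

(* [mrp_markov] is the Markov property in multiplied-out form: it says that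
   P(X_{n+1} = j, T_{n+1} - T_n <= t | past n) = Q_{X_n j}(t) almost surely,
   without dividing by the probability of the conditioning event. No condition
   is put on the law of X_0. *)
Record is_MRP (Q : 'I_m -> 'I_m -> cumulative R R) (P : probability Omega R)
    : Prop := {
  mrp_measurable_X : forall n i, measurable (X n @^-1` [set i]);
  mrp_measurable_T : forall n, measurable_fun setT (T n);
  mrp_T0 : forall w, T 0%N w = 0;
  mrp_mono : forall n w, T n w <= T n.+1 w;
  mrp_markov : forall (n : nat) (A : set Omega) (i j : 'I_m) (t : R),
    past n A ->
    P (A `&` jump n i j t) = ((Q i j t)%:E * P (A `&` X n @^-1` [set i]))%E }.

(* T_n for the least n >= 1 with X_n = j, and +oo if j is never entered. *)
Definition first_passage (j : 'I_m) (w : Omega) : \bar R :=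
  match pselect (exists n, (0 < n)%N && (X n w == j)) with
  | left h => (T (ex_minn h) w)%:E
  | right _ => +oo%E
  end.

(* [Pr i] is the law of the process given X_0 = i. *)
Variable Pr : 'I_m -> probability Omega R.

Definition mean_first_passage (i j : 'I_m) : \bar R :=
  (\int[Pr i]_w first_passage j w)%E.

Definition k2 (varpi : 'cV[R]_m) (i : 'I_m) : \bar R :=
  (\sum_(j < m) (varpi j 0)%:E * mean_first_passage i j)%E.

End MarkovRenewalProcess.

(* Stationary vector of the semi-Markov process X(t) = X_n, T_n <= t < T_{n+1}. *)
Definition smp_stationary (R : realType) (m : nat) (pi mu : 'cV[R]_m)
    : 'cV[R]_m :=
  \col_j (pi j 0 * mu j 0 / (pi^T *m mu) 0 0).

(* Main.v *)
(* Let N be P with column j set to zero. By the Markov property, the probability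
   of being in k at step n without having entered j at steps 1, ..., n is
   (N^n)_ik, and the mean of T_{n+1} - T_n on that event, summed over k, is
   (N^n mu)_i; hence m_ij = sum_n (N^n mu)_i. The maximum principle for the
   irreducible P makes I - N invertible, so this series is finite and
   m_j = mu + N m_j, that is (I - P) (m_j - m_jj e_j) = mu - m_jj e_j. Multiplying
   by pi^T gives m_jj = lambda / pi_j. A g-inverse G solves the system up to a
   multiple of e, fixed by the vanishing of the j-th entry, and averaging against
   varpi gives (a). The matrices in (b), (c), (d) are all g-inverses. *)
Require Import Defs.
From HB Require Import structures.
From mathcomp Require Import all_boot all_order all_algebra.
From mathcomp Require Import all_classical all_reals all_analysis.
From mathcomp Require Import measurable_realfun ring lra.

Set Implicit Arguments.
Unset Strict Implicit.
Unset Printing Implicit Defensive.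

Import Order.TTheory GRing.Theory Num.Theory.
Import numFieldNormedType.Exports.

Local Open Scope classical_set_scope.
Local Open Scope ring_scope.

(** * Linear algebra of an irreducible stochastic matrix *)

Lemma unitmx_ker0 (F : fieldType) (n : nat) (A : 'M[F]_n) :
  (forall x : 'cV[F]_n, A *m x = 0 -> x = 0) -> A \in unitmx.
Proof.
move=> kerA; rewrite -unitmx_tr -row_free_unit -kermx_eq0.
apply/eqP/row_matrixP => k; rewrite row0.
set y := row k _; have : y *m A^T = 0 by apply/sub_kermxP/row_sub.
move/(congr1 trmx); rewrite trmx_mul trmxK trmx0 => /kerA.
by move/(congr1 trmx); rewrite trmxK trmx0.
Qed.

Section StochasticMatrix.
Context {R : realType} {m : nat}.
Variable P : 'M[R]_m.
Hypothesis P_ge0 : forall i j, 0 <= P i j.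
Hypothesis P_evec : P *m evec = evec.
Hypothesis P_irr : irreducible_mx P.

Definition taboo (j : 'I_m) : 'M[R]_m :=
  \matrix_(i, k) if k == j then 0 else P i k.

Lemma taboo_mulmx j (x : 'cV[R]_m) :
  taboo j *m x = P *m x - x j 0 *: col j P.
Proof.
apply/colP => i; rewrite !mxE (bigD1 j)//= [in RHS](bigD1 j)//= !mxE eqxx mul0r.
rewrite add0r mulrC addrAC subrr add0r; apply: eq_bigr => k /negPf kj.
by rewrite mxE kj.
Qed.

Lemma row_sum1 i : \sum_k P i k = 1.
Proof.
have := congr1 (fun M : 'cV_m => M i 0) P_evec; rewrite !mxE => <-.
by apply: eq_bigr => k _; rewrite mxE mulr1.
Qed.

Lemma pow_predecessor n i k : 0 < (P ^+ n.+1) i k ->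
  exists l, 0 < (P ^+ n) i l /\ 0 < P l k.
Proof.
rewrite exprSr mxE => sum_gt0; apply: contrapT => none.
move: sum_gt0; rewrite ltNge sumr_le0// => l _; rewrite leNgt.
apply/negP => term_gt0; apply: none; exists l.
have Plk : 0 < P l k.
  rewrite lt_neqAle P_ge0 eq_sym andbT.
  by apply: contraTneq term_gt0 => ->; rewrite mulr0 ltxx.
by split => //; rewrite pmulr_lgt0 in term_gt0.
Qed.

(* Maximum principle: the states where |x| is maximal are closed under the
   transitions of P, and none of them leads to j. *)
Lemma taboo_fixed_eq0 j (x : 'cV[R]_m) : taboo j *m x = x -> x = 0.
Proof.
move=> Nx; have [i0 _ xmax] := arg_maxP (fun i => `|x i 0|) (erefl (predT j)).
pose c := `|x i0 0|.
have [c0|c0] := eqVneq c 0.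
  apply/colP => i; rewrite mxE; apply/eqP; rewrite -normr_le0 -c0.
  exact: xmax.
have cgt0 : 0 < c by rewrite lt_neqAle eq_sym c0 normr_ge0.
(* At a maximal state [i], the terms [c * P i l - |N_il x_l|] are nonnegative and have sum at most
   0, so each vanishes. For [l = j] the term is [c * P i j], which excludes a transition to [j]. *)
have closed i k : `|x i 0| = c -> 0 < P i k -> k != j /\ `|x k 0| = c.
  move=> xi Pik.
  have H : \sum_l (c * P i l - `|taboo j i l * x l 0|) <= 0.
    rewrite sumrB -mulr_sumr row_sum1 mulr1 subr_le0 -xi.
    have -> : x i 0 = (taboo j *m x) i 0 by rewrite Nx.
    by rewrite mxE ler_norm_sum.
  have term_ge0 l : 0 <= c * P i l - `|taboo j i l * x l 0|.
    rewrite subr_ge0 normrM mxE; case: ifP => _.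
      by rewrite normr0 mul0r mulr_ge0// ltW.
    by rewrite mulrC (ger0_norm (P_ge0 _ _)) ler_wpM2r//; exact: xmax.
  have {H} : \sum_l (c * P i l - `|taboo j i l * x l 0|) = 0.
    by apply/le_anti; rewrite H sumr_ge0.
  move/eqP; rewrite psumr_eq0// => /allP/(_ k (mem_index_enum _)) /=.
  rewrite mxE; case: (k == j).
    by rewrite mul0r normr0 subr0 mulf_eq0 (negPf c0) gt_eqF.
  rewrite normrM (ger0_norm (P_ge0 _ _)) [c * _]mulrC -mulrBr mulf_eq0 gt_eqF//=.
  by rewrite subr_eq0 => /eqP <-.
have reach n i k : `|x i 0| = c -> 0 < (P ^+ n) i k -> `|x k 0| = c.
  elim: n i k => [|n IHn] i k xi.
    by rewrite expr0 mxE; case: eqP => [<-//|_]; rewrite ltxx.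
  move=> /pow_predecessor[l [Pil Plk]].
  by have [] := closed l k (IHn i l xi Pil) Plk.
(* Irreducibility gives a path from [i] to [j], of positive length since [i != j]; its last step
   would enter [j] from a maximal state. *)
have off_j i : i != j -> `|x i 0| = c -> False.
  move=> ij xi; have [[|n]] := P_irr i j.
    by rewrite expr0 mxE (negPf ij) ltxx.
  move=> /pow_predecessor[l [Pil Plj]].
  by have [] := closed l j (reach n i l xi Pil) Plj; rewrite eqxx.
(* The maximal state [i0] may be [j] itself, so one step is taken first: any successor [l] is
   maximal and differs from [j]. *)
exfalso; have [l Pl] : exists l, 0 < P i0 l.
  apply: contrapT => H; have := row_sum1 i0; rewrite big1 => [H1|l _].
    by move/eqP: H1; rewrite eq_sym oner_eq0.
  apply/eqP; apply: contrapT => /negP Pl; apply: H; exists l.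
  by rewrite lt_neqAle eq_sym Pl P_ge0.
by have [lj xl] := closed i0 l erefl Pl; exact: off_j lj xl.
Qed.

(** On vectors with vanishing [j]-th entry, [P] and [taboo j] agree. Hence [x - x_j e] is fixed by
    [taboo j] and is zero. *)
Lemma harmonic_const j (x : 'cV[R]_m) : P *m x = x -> x = x j 0 *: evec.
Proof.
move=> Px; apply/eqP; rewrite -subr_eq0; apply/eqP/(@taboo_fixed_eq0 j).
by rewrite taboo_mulmx !mxE mulr1 subrr scale0r subr0 mulmxBr -scalemxAr P_evec Px.
Qed.

(** * Convergence of the series of taboo powers *)

Section TabooSeries.
Variable j : 'I_m.
Let N := taboo j.

Lemma taboo_ge0 i k : 0 <= N i k.
Proof. by rewrite mxE; case: ifP. Qed.

Lemma taboo_pow_ge0 n i k : 0 <= (N ^+ n) i k.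
Proof.
elim: n i k => [|n IHn] i k; first by rewrite expr0 mxE ler0n.
by rewrite exprS mxE sumr_ge0// => l _; rewrite mulr_ge0 ?taboo_ge0.
Qed.

Lemma taboo_contraction (x : 'cV[R]_m) c :
  (forall i, `|x i 0| <= c) -> forall i, `|(N *m x) i 0| <= c.
Proof.
move=> xc i; have c0 : 0 <= c by apply: le_trans (xc i); rewrite normr_ge0.
rewrite mxE (le_trans (ler_norm_sum _ _ _))//.
rewrite -[c]mul1r -(row_sum1 i) mulr_suml ler_sum// => k _.
rewrite normrM (ger0_norm (taboo_ge0 _ _)) ler_pM ?taboo_ge0//.
by rewrite mxE; case: ifP.
Qed.

Lemma taboo_unit : 1%:M - N \in unitmx.
Proof.
apply: unitmx_ker0 => x; rewrite mulmxBl mul1mx => /eqP.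
by rewrite subr_eq0 => /eqP/esym; exact: taboo_fixed_eq0.
Qed.

(** With [x = (I - N)^-1 b] the partial sums are [x - N^n x]. They are bounded because [N] does not
    increase the sup norm, and nondecreasing because [b] is nonnegative, so they converge. The
    equation for the limit comes from passing to the limit in [S (n+1) = b + N S n]. *)
Lemma taboo_series_cvg (b : 'cV[R]_m) : (forall i, 0 <= b i 0) ->
  exists2 v : 'cV[R]_m, v = b + N *m v &
    forall i, series (fun n => (N ^+ n *m b) i 0) @ \oo --> v i 0.
Proof.
move=> b0; pose S n : 'cV[R]_m := \sum_(k < n) N ^+ k *m b.
have SE i n : series (fun n => (N ^+ n *m b) i 0) n = S n i 0.
  by rewrite /series/= big_mkord /S summxE.
have SS n : S n.+1 = b + N *m S n.
  rewrite /S big_ord_recl expr0 mul1mx mulmx_sumr; congr (_ + _).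
  by apply: eq_bigr => k _; rewrite exprS mulmxA.
pose x := invmx (1%:M - N) *m b.
have xE : x - N *m x = b.
  by rewrite -{1}[x]mul1mx -mulmxBl mulKVmx// taboo_unit.
have SxE n : S n = x - N ^+ n *m x.
  elim: n => [|n IHn]; first by rewrite /S big_ord0 expr0 mul1mx subrr.
  by rewrite SS IHn -{1}xE mulmxBr addrA subrK exprS -mulmxA.
pose c := \sum_k `|x k 0|.
have xc i : `|x i 0| <= c.
  by rewrite /c (bigD1 i)//= lerDl sumr_ge0.
have Nxc n i : `|(N ^+ n *m x) i 0| <= c.
  elim: n i => [|n IHn] i; first by rewrite expr0 mul1mx.
  by rewrite exprS -mulmxA taboo_contraction.
have term_ge0 i n : 0 <= (N ^+ n *m b) i 0.
  by rewrite mxE sumr_ge0// => k _; rewrite mulr_ge0 ?taboo_pow_ge0.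
have Scvg i : cvgn (fun n => S n i 0).
  apply: nondecreasing_is_cvgn.
    apply/nondecreasing_seqP => n; rewrite -!SE /series/= big_nat_recr//=.
    by rewrite lerDl.
  exists (c + c) => _ [n _ <-]; rewrite SxE mxE [X in _ + X]mxE lerD//.
    exact: le_trans (ler_norm _) (xc i).
  by rewrite (le_trans (ler_norm _))// normrN.
exists (\col_i limn (fun n => S n i 0)); last first.
  move=> i; rewrite mxE; have -> : series (fun n => (N ^+ n *m b) i 0) =
    (fun n => S n i 0) by apply/funext => n; rewrite SE.
  exact: Scvg.
apply/colP => i; rewrite [LHS]mxE.
apply/cvg_lim => //; rewrite -(cvg_shiftS (fun n => S n i 0)).
under eq_fun do rewrite SS mxE [X in _ + X]mxE.
rewrite mxE [X in _ + X]mxE; apply: cvgD; first exact: cvg_cst.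
apply: cvg_big => [|k _]; first exact: add_continuous.
by apply: cvgMl_tmp; rewrite mxE; exact: Scvg.
Qed.

End TabooSeries.

(** * Perturbed inverses, and passage times expressed by a g-inverse *)

Section Stationary.
Variables (pi mu : 'cV[R]_m).
Hypothesis pi_P : pi^T *m P = pi^T.
Let lambda : R := (pi^T *m mu) 0 0.
Hypothesis lambda_gt0 : 0 < lambda.

(** If [x] is in the kernel, multiplying by [pi^T] leaves [(pi^T b)(u^T x) = 0], so [u^T x = 0].
    Then [x] is harmonic, hence a multiple of [e], and [u^T e != 0] makes it zero. *)
Lemma stationary_perturbation_unit (b u : 'cV[R]_m) :
  (pi^T *m b) 0 0 != 0 -> (u^T *m evec) 0 0 != 0 ->
  1%:M - P + b *m u^T \in unitmx.
Proof.
move=> pib ue; apply: unitmx_ker0 => x.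
rewrite !mulmxDl mulNmx mul1mx -mulmxA => Hx.
have ux : u^T *m x = 0.
  have := congr1 (mulmx pi^T) Hx.
  rewrite mulmx0 mulmxDr mulmxBr !mulmxA pi_P subrr add0r -mulmxA => H.
  move/(congr1 (fun M : 'M[R]_1 => M 0 0)): H => H.
  apply/matrixP => a c; rewrite !ord1 [RHS]mxE; move: H; rewrite mxE big_ord1 [RHS]mxE.
  by move/eqP; rewrite mulf_eq0 (negPf pib) => /eqP.
move: Hx; rewrite ux mulmx0 addr0 => /eqP; rewrite subr_eq0 => /eqP/esym Px.
apply/colP => j; rewrite [RHS]mxE.
have xE := harmonic_const j Px.
move: ux; rewrite {1}xE -scalemxAr => /(congr1 (fun M : 'M[R]_1 => M 0 0)).
by rewrite [LHS]mxE [RHS]mxE => /eqP; rewrite mulf_eq0 (negPf ue) orbF => /eqP.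
Qed.

(** Let [B] be the perturbed matrix. From [pi^T B = (pi^T b) u^T], the row [u^T B^-1] is a multiple
    of [pi^T]. So [(I - P) B^-1] is [I] minus a multiple of [b pi^T], and the latter is killed by
    [I - P] on the right. *)
Lemma stationary_perturbation_ginverse (b u : 'cV[R]_m) :
  (pi^T *m b) 0 0 != 0 -> (u^T *m evec) 0 0 != 0 ->
  is_ginverse (1%:M - P) (invmx (1%:M - P + b *m u^T)).
Proof.
move=> pib ue; have BU := stationary_perturbation_unit pib ue.
set B := 1%:M - P + b *m u^T in BU *.
have piB : pi^T *m B = (pi^T *m b) 0 0 *: u^T.
  rewrite mulmxDr mulmxBr mulmx1 pi_P subrr add0r mulmxA.
  by rewrite {1}[pi^T *m b]mx11_scalar mul_scalar_mx.
have uG : u^T *m invmx B = ((pi^T *m b) 0 0)^-1 *: pi^T.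
  move: pib piB; set c := (pi^T *m b) 0 0 => pib piB.
  by rewrite -[pi^T](mulmxK BU) piB -scalemxAl scalerA mulVf// scale1r.
rewrite /is_ginverse; have -> : 1%:M - P = B - b *m u^T by rewrite addrK.
rewrite [(B - _) *m invmx B]mulmxBl mulmxV// -mulmxA uG mulmxBl mul1mx.
rewrite -!scalemxAr -scalemxAl.
rewrite [X in _ - _ *: X](_ : _ = 0) ?scaler0 ?subr0//.
by rewrite addrK -mulmxA mulmxBr mulmx1 pi_P subrr mulmx0.
Qed.

(** Since [(I - P) e = 0], the perturbed matrix sends [e] to [(u^T e) b]. With [b = mu] this is what
    simplifies (d). *)
Lemma perturbation_inv_mulmx (b u : 'cV[R]_m) :
  (pi^T *m b) 0 0 != 0 -> (u^T *m evec) 0 0 != 0 ->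
  invmx (1%:M - P + b *m u^T) *m b = ((u^T *m evec) 0 0)^-1 *: evec.
Proof.
move=> pib ue; have BU := stationary_perturbation_unit pib ue.
apply: (canLR (mulKmx BU)); rewrite -scalemxAr mulmxDl mulmxBl mul1mx P_evec.
rewrite subrr add0r -mulmxA; have := mx11_scalar (u^T *m evec).
set c := (u^T *m evec) 0 0 in ue *.
by move=> ->; rewrite mul_mx_scalar scalerA mulVf// scale1r.
Qed.

(** [v j] stands for column [j] of the mean first passage matrix, represented here by its linear
    system. *)
Variable v : 'I_m -> 'cV[R]_m.
Hypothesis v_eq : forall j, v j = mu + taboo j *m v j.

(** The product form turns [varpi_j v_jj] into [mu_j] without dividing by [pi_j]. *)
Lemma return_time j : pi j 0 * v j j 0 = lambda.
Proof.
have := congr1 (fun x : 'cV_m => (pi^T *m x) 0 0) (v_eq j).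
rewrite taboo_mulmx !(mulmxDr, mulmxN) !mulmxA pi_P -scalemxAr colE mulmxA pi_P.
rewrite -colE /lambda; move: (pi^T *m v j) (pi^T *m mu) (v j j 0) => s t a.
by rewrite !mxE; lra.
Qed.

(** The vector [w = v_j - v_jj e_j] satisfies [(I - P) w = mu - v_jj e_j]. Then [w - G (I - P) w] is
    harmonic, hence constant, and its value is read off at [j], where [w] vanishes. *)
Lemma passage_time_ginverse (G : 'M[R]_m) i j : is_ginverse (1%:M - P) G ->
  v j i 0 = v j j 0 * (i == j)%:R + (G *m mu) i 0 - v j j 0 * G i j
            - (G *m mu) j 0 + v j j 0 * G j j.
Proof.
rewrite /is_ginverse => AGA; set a := v j j 0; set A := 1%:M - P in AGA.
pose ej : 'cV[R]_m := delta_mx j 0.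
pose w := v j - a *: ej.
have Aw : A *m w = mu - a *: ej.
  rewrite /w mulmxBr -scalemxAr !mulmxBl !mul1mx.
  have := v_eq j; rewrite taboo_mulmx -/a colE -/ej.
  move: (v j) (P *m v j) (P *m ej) => x y z xE; apply/colP => k.
  by have := congr1 (fun x : 'cV_m => x k 0) xE; rewrite !mxE; lra.
have : P *m (w - G *m (A *m w)) = w - G *m (A *m w).
  apply/esym/eqP; rewrite -subr_eq0 -{1}[_ - G *m _]mul1mx -mulmxBl -/A.
  by rewrite mulmxBr !mulmxA AGA subrr.
move/(harmonic_const j); rewrite Aw => /(congr1 (fun x : 'cV_m => x i 0)).
rewrite mulmxBr -scalemxAr /ej -colE.
move: (G *m mu) => g; rewrite !mxE !eqxx !mulr1 andbT -/a => H.
by apply/eqP; rewrite -subr_eq0; apply/eqP; move: H; set x := v j i 0; lra.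
Qed.

Lemma mixed_passage_time (G : 'M[R]_m) i : is_ginverse (1%:M - P) G ->
  \sum_j smp_stationary pi mu j 0 * v j i 0 =
  ((1%:M + Emx *m diagpart G
    - lambda^-1 *: (Emx *m diagpart (G *m mu *m pi^T))) *m mu) i 0.
Proof.
move=> GG; have l0 : lambda != 0 by rewrite gt_eqF.
pose varpi j := smp_stationary pi mu j 0.
have varpiE j : varpi j = pi j 0 * mu j 0 / lambda by rewrite /varpi mxE.
have sum_varpi : \sum_j varpi j = 1.
  under eq_bigr do rewrite varpiE; rewrite -mulr_suml.
  by rewrite [X in X / _](_ : _ = lambda) ?divff// /lambda mxE; apply: eq_bigr => k _; rewrite mxE.
(* Each [varpi_j v_jj] has become [mu_j]. As [varpi] sums to 1, the second and third terms sum to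
   [(G mu)_i] and [- (G mu)_i] and cancel. *)
transitivity (\sum_j (mu j 0 * (i == j)%:R + varpi j * (G *m mu) i 0
   - G i j * mu j 0 - varpi j * (G *m mu) j 0 + G j j * mu j 0)).
  apply: eq_bigr => j _; rewrite -/(varpi j) (passage_time_ginverse i j GG).
  have : varpi j * v j j 0 = mu j 0.
    by rewrite varpiE mulrAC [_ * v j j 0]mulrAC return_time mulrAC divff// mul1r.
  move: (v j j 0) (G *m mu) => a g <-; ring.
rewrite !big_split/= !sumrN -mulr_suml sum_varpi mul1r.
rewrite (bigD1 i)//= eqxx mulr1 big1 ?addr0; last first.
  by move=> k /negPf ki; rewrite eq_sym ki mulr0.
have E : (G *m mu) i 0 = \sum_j G i j * mu j 0 by rewrite mxE.
rewrite -E addrK.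
(* Every row of [E D_d] is the diagonal of [D]. *)
have EmxD (D : 'M[R]_m) : (Emx *m diagpart D *m mu) i 0 = \sum_j D j j * mu j 0.
  rewrite mxE; apply: eq_bigr => k _; congr (_ * _); rewrite mxE (bigD1 k)//=.
  rewrite !mxE big_ord1 !mxE eqxx mulr1n !mul1r big1 ?addr0// => l lk.
  by rewrite !mxE (negPf lk) mulr0n mulr0.
rewrite !mulmxDl mulNmx mul1mx -scalemxAl.
rewrite [RHS](_ : _ = mu i 0 + (Emx *m diagpart G *m mu) i 0
    - lambda^-1 * (Emx *m diagpart (G *m mu *m pi^T) *m mu) i 0); last first.
  by move: (_ *m mu) (_ *m mu) => x y; rewrite !mxE.
rewrite !EmxD.
rewrite addrAC; congr (_ + _ - _); rewrite mulr_sumr; apply: eq_bigr => j _.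
by rewrite varpiE; move: (G *m mu) => g; rewrite !mxE big_ord1 mxE -/lambda; field.
Qed.

End Stationary.
End StochasticMatrix.

(** * The Markov renewal process *)

(** Total expectation over the values of a finite-valued map, used to split events by [X n] and
    [X n.+1]. *)
Lemma ge0_integral_fibers d (Omega : measurableType d) (R : realType)
    (I : finType) (mu : {measure set Omega -> \bar R}) (D : set Omega)
    (Y : Omega -> I) (f : Omega -> \bar R) :
  measurable D -> (forall i, measurable (Y @^-1` [set i])) ->
  measurable_fun D f -> (forall w, D w -> (0 <= f w)%E) ->
  (\int[mu]_(w in D) f w =
   \sum_(i : I) \int[mu]_(w in D `&` Y @^-1` [set i]) f w)%E.
Proof.
move=> mD mY mf f0.
have DE : D = \big[setU/set0]_(i <- enum I) (D `&` Y @^-1` [set i]).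
  rewrite -bigcup_seq; apply/seteqP; split => [w Dw|w [i _ []//]].
  by exists (Y w) => //=; rewrite mem_enum.
rewrite {1}DE ge0_integral_bigsetU ?enum_uniq// -?DE//.
- by rewrite big_enum.
- by move=> i; apply: measurableI.
- exact: trivIset_preimage1_in.
Qed.

Lemma measure_fibers d (Omega : measurableType d) (R : realType)
    (I : finType) (mu : {measure set Omega -> \bar R}) (D : set Omega)
    (Y : Omega -> I) :
  measurable D -> (forall i, measurable (Y @^-1` [set i])) ->
  (mu D = \sum_(i : I) mu (D `&` Y @^-1` [set i]))%E.
Proof.
move=> mD mY; have := @ge0_integral_fibers _ _ _ _ mu D Y (cst 1%E) mD mY.
rewrite integral_cst// mul1e => -> //.
by apply: eq_bigr => i _; rewrite integral_cst ?mul1e//; exact: measurableI.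
Qed.

Lemma ge0_integral_mrestr d (Omega : measurableType d) (R : realType)
    (mu : {measure set Omega -> \bar R}) (D : set Omega) (mD : measurable D)
    (f : Omega -> \bar R) :
  measurable_fun setT f -> (forall w, 0 <= f w)%E ->
  (\int[mrestr mu mD]_w f w = \int[mu]_(w in D) f w)%E.
Proof.
move=> mf f0; rewrite (@ge0_negligible_integral _ _ _ _ setT (~` D))//=.
- rewrite setDE setCK setTI; apply: eq_measure_integral => A mA AD.
  by rewrite /= /mrestr setIidl.
- exact: measurableC.
- by rewrite /mrestr setICl measure0.
Qed.

(** The intervals []a, b]] are stable under intersection and generate the Borel sets, and the []-k,
    k]] exhaust the line with finite measure, so the uniqueness theorem for measures applies. *)
Lemma lebesgue_stieltjes_measure_scale_unique (R : realType)
    (F : cumulative R R) (q : {nonneg R})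
    (nu : {measure set (measurableTypeR R) -> \bar R}) :
  (forall a b, a < b -> nu `]a, b]%classic = (q%:num * (F b - F a))%:E) ->
  forall C, measurable C -> nu C = mscale q (lebesgue_stieltjes_measure F) C.
Proof.
move=> nuE.
have lsE a b : a < b ->
    lebesgue_stieltjes_measure F `]a, b]%classic = (F b - F a)%:E.
  move=> ab; rewrite /lebesgue_stieltjes_measure /measure_extension measurable_mu_extE/=.
    by rewrite wlength_itv/= lte_fin ab EFinB.
  exact: is_ocitv.
apply: (@measure_unique _ R (measurableTypeR R) (@ocitv R) (fun k => `](- k%:R), k%:R]%classic)) => //.
- exact: ocitvI.
- by move=> k; exact: is_ocitv.
- apply/seteqP; split => // x _; exists (Num.bound `|x|) => //=.
  have := archi_boundP (normr_ge0 x); rewrite ltr_norml => /andP[lx xu].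
  by rewrite in_itv/= lx ltW.
- move=> _ /ocitvP[->|[[a b]/= ab ->]]; first by rewrite !measure0.
  by rewrite nuE// /mscale/= lsE.
- move=> [|k]; first by rewrite oppr0 set_itv_ge ?measure0 ?bnd_simp ?ltxx.
  by rewrite nuE ?ltry// gt0_cp ?ltr0Sn.
Qed.

(** * One-step consequences of the Markov property *)

Section MarkovRenewal.
Context {d : measure_display} {Omega : measurableType d} {R : realType}.
Context {m : nat}.
Variables (X : nat -> Omega -> 'I_m) (T : nat -> Omega -> R).
Variables (Q : 'I_m -> 'I_m -> cumulative R R) (Pr : probability Omega R).
Hypothesis mrp : is_MRP X T Q Pr.
Variable P : 'M[R]_m.
Hypothesis Q_cvg : forall i j, Q i j t @[t --> +oo] --> P i j.

Let mX n i : measurable (X n @^-1` [set i]) := mrp_measurable_X mrp n i.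
Let mT n : measurable_fun setT (T n) := mrp_measurable_T mrp n.

Definition sojourn n w := T n.+1 w - T n w.

Lemma sojourn_ge0 n w : 0 <= sojourn n w.
Proof. by rewrite subr_ge0; exact: (mrp_mono mrp). Qed.

Lemma measurable_sojourn n : measurable_fun setT (sojourn n).
Proof. exact: measurable_funB. Qed.

Lemma past_measurable n A : past X T n A -> measurable A.
Proof.
apply: smallest_sub; first exact: sigma_algebra_measurable.
move=> _ [k _ [[B _ <-]|[B mB <-]]]; last exact: mT.
rewrite setTI (_ : _ @^-1` B = \bigcup_(i in B) X k @^-1` [set i]).
  by apply: fin_bigcup_measurable => //; exact: finite_finset.
by apply/seteqP; split => [w Bw|w [i Bi /= ->]//]; exists (X k w).
Qed.

(** Index 0 is left out: a path started in [j] has not yet returned there. *)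
Definition avoid (j : 'I_m) n : set Omega :=
  [set w | forall r, (0 < r <= n)%N -> X r w != j].

Lemma avoid0 j : avoid j 0 = setT.
Proof.
apply/seteqP; split => // w _ r; rewrite leqn0 => /andP[].
by case: r.
Qed.

Lemma avoidS j n : avoid j n.+1 = avoid j n `&` ~` (X n.+1 @^-1` [set j]).
Proof.
apply/seteqP; split => w /=.
  move=> H; split => [r /andP[r0 rn]|].
    by apply: H; rewrite r0 leqW.
  by apply/eqP; apply: H; rewrite ltnSn.
move=> [H Xj] r; rewrite [(r <= _)%N]leq_eqVlt ltnS => /andP[r0 /predU1P[->|rn]].
  exact/eqP.
by apply: H; rewrite r0.
Qed.

Lemma past_avoid (j : 'I_m) n : past X T n (avoid j n).
Proof.
elim: n => [|n IHn].
  by rewrite avoid0 -(setD0 setT); apply: sigma_algebraCD; exact: sigma_algebra0.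
rewrite avoidS -[_ `&` _]setCK setCI setCK.
rewrite -setTD; apply: sigma_algebraCD; rewrite -bigcup2E.
apply: sigma_algebra_bigcup => -[|[|k]]/=; last exact: sigma_algebra0.
- rewrite -setTD; apply: sigma_algebraCD.
  apply: sub_sigma_algebra2 IHn => B [k /= kn HB].
  by exists k => //=; exact: leqW.
- apply: sub_sigma_algebra; exists n.+1 => //=; left.
  by exists [set j] => //; rewrite setTI.
Qed.


Lemma measurable_avoid (j : 'I_m) n : measurable (avoid j n).
Proof. by apply: (@past_measurable n); exact: past_avoid. Qed.

Lemma measurable_jump n i j t : measurable (jump X T n i j t).
Proof.
rewrite (_ : jump _ _ _ _ _ _ =
  X n @^-1` [set i] `&` X n.+1 @^-1` [set j] `&` sojourn n @^-1` `]-oo, t]).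
  apply: measurableI; first exact: measurableI.
  by rewrite -[X in measurable X]setTI; exact: measurable_sojourn.
by apply/seteqP; split => w /=; rewrite in_itv/=; [case|case; case].
Qed.

(** Let [t] tend to infinity along the integers in the Markov property: sojourns are finite, so the
    jump events increase to the event without time bound, and continuity from below applies. *)
Lemma markov_step n A i k : past X T n A ->
  Pr (A `&` X n @^-1` [set i] `&` X n.+1 @^-1` [set k]) =
  ((P i k)%:E * Pr (A `&` X n @^-1` [set i]))%E.
Proof.
move=> pA; have mA := past_measurable pA.
pose F (N : nat) := A `&` jump X T n i k N%:R.
have mF N : measurable (F N) by apply: measurableI => //; exact: measurable_jump.
have UF : \bigcup_N F N = A `&` X n @^-1` [set i] `&` X n.+1 @^-1` [set k].
  apply/seteqP; split => [w [N _ [Aw [/= ? ? _]]]//|w [[Aw Xi] Xk]].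
  exists (Num.bound (sojourn n w)) => //; split => //; split => //.
  apply/ltW; rewrite -/(sojourn n w).
  by apply: le_lt_trans (archi_boundP (sojourn_ge0 n w)).
have : Pr \o F @ \oo --> Pr (\bigcup_N F N).
  apply: nondecreasing_cvg_mu => //; first exact: bigcup_measurable.
  apply/nondecreasing_seqP => N; apply/subsetPset => w [Aw [/= Xi Xk le]].
  by split => //; split => //; rewrite (le_trans le)// ler_nat.
rewrite UF => cF; apply: (cvg_unique _ cF) => //.
have -> : Pr \o F = fun N => ((Q i k N%:R)%:E * Pr (A `&` X n @^-1` [set i]))%E.
  by apply/funext => N /=; exact: (mrp_markov mrp).
apply: cvgeZr; first by rewrite fin_num_measure//; exact: measurableI.
apply: cvg_EFin; first exact: nearW.
have /cvg_pinftyP := Q_cvg (i:=i) (j:=k); apply; exact: cvgr_idn.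
Unshelve. all: by end_near. Qed.

(** The law of the sojourn under [Pr] restricted to [B] gives []a, b]] the mass [p (Q b - Q a)]. It
    is therefore [p] times the Stieltjes measure of [Q i k], and integrating the identity against it
    gives the claim, also when [p = 0]. *)
Lemma markov_sojourn n A i k : past X T n A ->
  (\int[Pr]_(w in A `&` X n @^-1` [set i] `&` X n.+1 @^-1` [set k])
     (sojourn n w)%:E = mean_time Q i k * Pr (A `&` X n @^-1` [set i]))%E.
Proof.
move=> pA; have mA := past_measurable pA.
set p := Pr (A `&` X n @^-1` [set i]).
set B := A `&` _ `&` _.
have mB : measurable B by apply: measurableI => //; exact: measurableI.
have mfs := @measurable_sojourn n.
pose phi : Omega -> measurableTypeR R := sojourn n.
have mphi : measurable_fun setT phi by [].
have pfin : p \is a fin_num by rewrite fin_num_measure//; exact: measurableI.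
have p0 : 0 <= fine p by rewrite fine_ge0 ?measure_ge0.
pose q : {nonneg R} := NngNum p0.
have nuE (C : set (measurableTypeR R)) : measurable C ->
    pushforward (mrestr Pr mB) phi C =
    mscale q (lebesgue_stieltjes_measure (Q i k)) C.
  apply: (@lebesgue_stieltjes_measure_scale_unique _ _ _ (pushforward (mrestr Pr mB) phi)) => a b ab.
  have mAj t : measurable (A `&` jump X T n i k t).
    by apply: measurableI => //; exact: measurable_jump.
  transitivity (Pr ((A `&` jump X T n i k b) `\` (A `&` jump X T n i k a))).
    congr (Pr _); apply/seteqP; split => w /=; rewrite in_itv/= -/(sojourn n w).
      move=> [/andP[aw wb] [[Aw Xi] Xk]]; split => // -[_ [_ _]].
      by rewrite -/(sojourn n w) leNgt aw.
    move=> [[Aw [/= Xi Xk wb]] nj]; split; last by [].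
    rewrite wb andbT ltNge; apply/negP => wa; apply: nj.
    by split.
  transitivity (Pr (A `&` jump X T n i k b) - Pr (A `&` jump X T n i k a))%E.
    rewrite measureD//; last by rewrite (le_lt_trans (probability_le1 _ _)) ?ltry.
    congr (_ - Pr _)%E; apply: setIidr => w [Aw [/= Xi Xk wa]].
    by split => //; split => //; exact: le_trans wa (ltW ab).
  rewrite !(mrp_markov mrp)// -/p -(fineK pfin) -!EFinM -EFinB.
  by rewrite -mulrBl mulrC.
rewrite -(ge0_integral_mrestr Pr mB); last 2 first.
- exact/measurable_EFinP.
- by move=> w; rewrite lee_fin sojourn_ge0.
(* Sojourns are nonnegative, so the domain can be matched with the half-line in [mean_time]. *)
have -> : [set: Omega] = phi @^-1` `[0, +oo[.
  by apply/seteqP; split => // w _ /=; rewrite in_itv/= sojourn_ge0.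
transitivity (\int[mscale q (lebesgue_stieltjes_measure (Q i k))]_(y in `[0%R, +oo[) y%:E)%E.
  rewrite -(eq_measure_integral _ (fun C mC _ => nuE C mC)).
  apply/esym; apply: (@ge0_integral_pushforward _ _ _ _ _ phi mphi (mrestr Pr mB) _ EFin) => //.
  by move=> y; rewrite inE/= in_itv/= andbT lee_fin.
rewrite ge0_integral_mscale//=; last by move=> y; rewrite in_itv/= andbT lee_fin.
by rewrite muleC fineK.
Qed.

End MarkovRenewal.

(** * The mean first passage time as a taboo series *)

Section FirstPassage.
Context {d : measure_display} {Omega : measurableType d} {R : realType}.
Context {m : nat}.
Variables (X : nat -> Omega -> 'I_m) (T : nat -> Omega -> R).
Variables (Q : 'I_m -> 'I_m -> cumulative R R) (Pr : probability Omega R).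
Hypothesis mrp : is_MRP X T Q Pr.
Variable P : 'M[R]_m.
Hypothesis Q_cvg : forall i j, Q i j t @[t --> +oo] --> P i j.
Variable i : 'I_m.
Hypothesis start : Pr (X 0%N @^-1` [set i]) = 1%E.

Let mX n k : measurable (X n @^-1` [set k]) := mrp_measurable_X mrp n k.

(** Induction on [n]: for [k = j] both sides vanish, and for [k != j] the event is split over [X n]
    and [markov_step] is applied. *)
Lemma survival j n k :
  Pr (avoid X j n `&` X n @^-1` [set k]) = ((taboo P j ^+ n) i k)%:E.
Proof.
have mav l := measurable_avoid mrp j l.
elim: n k => [|n IHn] k.
  rewrite avoid0 setTI expr0 mxE; case: eqVneq => [<-//|ik].
  apply/eqP; rewrite -measure_le0.
  have -> : 0%E = (1 - Pr (X 0%N @^-1` [set i]))%E by rewrite start subee.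
  rewrite -probability_setC//; apply: le_measure; rewrite ?inE//.
    exact: measurableC.
  by move=> w /= -> ki; rewrite ki eqxx in ik.
rewrite avoidS exprSr mxE; case: (eqVneq k j) => [->|kj].
  rewrite -setIA setICl setI0 measure0 big1// => l _.
  by rewrite [taboo _ _ _ _]mxE eqxx mulr0.
have -> : avoid X j n `&` ~` (X n.+1 @^-1` [set j]) `&` X n.+1 @^-1` [set k] =
    avoid X j n `&` X n.+1 @^-1` [set k].
  apply/seteqP; split => w /=; first by case; case.
  move=> [aw Xk]; split => //; split => // Xj.
  by rewrite -Xk Xj eqxx in kj.
rewrite (measure_fibers _ (Y := X n))//; last exact: measurableI.
rewrite -sumEFin; apply: eq_bigr => l _.
transitivity ((P l k)%:E * Pr (avoid X j n `&` X n @^-1` [set l]))%E.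
  by rewrite setIAC; apply: (markov_step mrp Q_cvg); exact: past_avoid.
by rewrite IHn -EFinM mulrC [taboo _ _ l k]mxE (negPf kj).
Qed.

Lemma mean_sojourn_avoid j n : (forall l k, mean_time Q l k < +oo)%E ->
  (\int[Pr]_(w in avoid X j n) (sojourn T n w)%:E =
   ((taboo P j ^+ n *m mean_sojourn Q) i 0)%:E)%E.
Proof.
move=> Qfin; have mav := measurable_avoid mrp j n.
have s0 w : (0 <= (sojourn T n w)%:E)%E by rewrite lee_fin (sojourn_ge0 mrp).
have ms D : measurable_fun D (fun w => (sojourn T n w)%:E).
  apply/measurable_EFinP; apply: measurable_funTS.
  exact: measurable_sojourn mrp n.
have Qge0 l k : (0 <= mean_time Q l k)%E.
  by apply: integral_ge0 => t /=; rewrite in_itv/= andbT lee_fin.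
rewrite (ge0_integral_fibers _ (Y := X n))// mxE -sumEFin.
apply: eq_bigr => l _.
rewrite (ge0_integral_fibers _ (Y := X n.+1))//; last exact: measurableI.
rewrite EFinM muleC mxE -sumEFin ge0_sume_distrl; last first.
  by move=> k _; rewrite lee_fin fine_ge0.
apply: eq_bigr => k _; rewrite (markov_sojourn mrp); last exact: past_avoid.
by rewrite survival fineK// ge0_fin_numE.
Qed.

(** If [N] is the first entry index, sojourn [n] counts exactly when [n < N], and the sum telescopes
    to [T N - T 0]. If [j] is never entered, the sum of the sojourns could still be finite, so the
    second term supplies the value [+oo]. *)
Lemma first_passageE j w :
  first_passage X T j w =
  (\sum_(n <oo) ((fun w => (sojourn T n w)%:E) \_ (avoid X j n)) w +
   (cst +oo \_ (\bigcap_n avoid X j n)) w)%E.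
Proof.
have s0 n : (0 <= ((fun w => (sojourn T n w)%:E) \_ (avoid X j n)) w)%E.
  by apply: erestrict_ge0 => ? _; rewrite lee_fin (sojourn_ge0 mrp).
rewrite /first_passage; case: pselect => [h|nh]; last first.
  rewrite [X in (_ + X)%E]patchE mem_set ?addey//.
    by rewrite -ltNye (lt_le_trans _ (nneseries_ge0 _))// => n _ _; exact: s0.
  move=> n _ r /andP[r0 _]; apply/negP => Xr; apply: nh; exists r.
  by rewrite r0.
case: ex_minnP => N /andP[N0 /eqP XN] Nmin.
have avE n : (w \in avoid X j n) = (n < N)%N.
  apply/idP/idP => [|nN]; rewrite inE.
    move=> aw; rewrite ltnNge; apply/negP => Nn.
    by have := aw N; rewrite N0 Nn XN eqxx => /(_ isT).
  move=> r /andP[r0 rn]; apply/negP => Xr.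
  have : (N <= r)%N by apply: Nmin; rewrite r0.
  by rewrite leqNgt (leq_ltn_trans rn nN).
rewrite [X in (_ + X)%E]patchE memNset ?adde0; last first.
  by move=> /(_ N I)/mem_set; rewrite avE ltnn.
(* The partial sums are constant from index [N] on. *)
apply/esym; apply: lim_near_cst => //; exists N => // K /= NK.
rewrite -(subnKC NK) big_mkord big_split_ord/= [X in (_ + X)%E]big1 ?adde0; last first.
  by move=> k _; rewrite patchE avE ltnNge leq_addr.
rewrite (eq_bigr (fun k : 'I_N => (T k.+1 w - T k w)%:E)); last first.
  by move=> k _; rewrite patchE avE ltn_ord.
rewrite sumEFin -(big_mkord xpredT (fun k => T k.+1 w - T k w)).
by rewrite telescope_sumr// (mrp_T0 mrp) subr0.
Qed.

Hypothesis Qfin : forall l k, (mean_time Q l k < +oo)%E.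
Hypothesis P_ge0 : forall i j, 0 <= P i j.
Hypothesis P_evec : P *m evec = evec.
Hypothesis P_irr : irreducible_mx P.

Lemma mean_first_passage_cvg j (v : R) :
  series (fun n => (taboo P j ^+ n *m mean_sojourn Q) i 0) @ \oo --> v ->
  (\int[Pr]_w first_passage X T j w = v%:E)%E.
Proof.
move=> cv.
have mav n := measurable_avoid mrp j n.
have mI : measurable (\bigcap_n avoid X j n) by exact: bigcapT_measurable.
have s0 n w : (0 <= (sojourn T n w)%:E)%E by rewrite lee_fin (sojourn_ge0 mrp).
have ms n D : measurable_fun D (fun w => (sojourn T n w)%:E).
  apply/measurable_EFinP; apply: measurable_funTS.
  exact: measurable_sojourn mrp n.
have Pav n : Pr (avoid X j n) = ((taboo P j ^+ n *m evec) i 0)%:E.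
  rewrite (measure_fibers _ (Y := X n))// mxE -sumEFin.
  by apply: eq_bigr => k _; rewrite [evec _ _]mxE mulr1; exact: survival.
(* The state [j] is almost surely entered: the taboo series with [b = e] converges, so its terms,
   the probabilities of avoiding [j] up to step [n], tend to 0. The infinite part of
   [first_passageE] thus lives on a null set. *)
have PI0 : Pr (\bigcap_n avoid X j n) = 0%E.
  apply/eqP; rewrite -measure_le0.
  have [|u _ /(_ i) cu] := @taboo_series_cvg _ _ _ P_ge0 P_evec P_irr j evec.
    by move=> k; rewrite mxE.
  have /cvg_series_cvg_0 c0 : cvgn (series (fun n => (taboo P j ^+ n *m evec) i 0)).
    by apply/cvg_ex; exists (u i 0).
  have c0E : (fun n => ((taboo P j ^+ n *m evec) i 0)%:E) @ \oo --> 0%E.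
    by apply: cvg_EFin => //; exact: nearW.
  apply: (cvge_ge _ c0E); apply: nearW => n; rewrite -Pav.
  by apply: le_measure; rewrite ?inE//; exact: bigcap_inf.
under eq_integral do rewrite first_passageE.
have r0 n w : (0 <= ((fun w => (sojourn T n w)%:E) \_ (avoid X j n)) w)%E.
  by apply: erestrict_ge0 => ? _; exact: s0.
have mr n : measurable_fun setT ((fun w => (sojourn T n w)%:E) \_ (avoid X j n)).
  exact/(measurable_restrictT _ (mav n)).1.
rewrite ge0_integralD//; first last.
- exact/(measurable_restrictT _ mI).1.
- by move=> w _; apply: erestrict_ge0 => ? _; rewrite leey.
- exact: ge0_emeasurable_sum.
- by move=> w _; exact: nneseries_ge0.
have -> : (\int[Pr]_w (cst +oo \_ (\bigcap_n avoid X j n)) w = 0)%E.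
  rewrite -integral_mkcond; transitivity (+oo * Pr (\bigcap_n avoid X j n))%E.
    exact: integral_cst.
  by rewrite PI0 mule0.
rewrite adde0.
rewrite integral_nneseries//.
transitivity (\sum_(n <oo) ((taboo P j ^+ n *m mean_sojourn Q) i 0)%:E)%E.
  by apply: eq_eseriesr => n _; rewrite -integral_mkcond mean_sojourn_avoid.
apply/cvg_lim => //; rewrite [X in X @ _ --> _](_ : _ =
  EFin \o series (fun n => (taboo P j ^+ n *m mean_sojourn Q) i 0)).
  by apply: cvg_EFin => //; exact: nearW.
by apply/funext => n; rewrite /series/= sumEFin.
Qed.

End FirstPassage.

(** * Stochasticity of the embedded chain and the passage time system *)

Section EmbeddedChain.
Context {d : measure_display} {Omega : measurableType d} {R : realType}.
Context {m : nat}.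
Variables (X : nat -> Omega -> 'I_m) (T : nat -> Omega -> R).
Variables (Q : 'I_m -> 'I_m -> cumulative R R).
Variable Pr : 'I_m -> probability Omega R.
Hypothesis mrp : forall i, is_MRP X T Q (Pr i).
Hypothesis start : forall i, Pr i (X 0%N @^-1` [set i]) = 1%E.

(** Started in [i], the kernel is an actual probability, which bounds it between 0 and 1. *)
Lemma kernel_initial i j t : (Q i j t)%:E = Pr i (jump X T 0 i j t).
Proof.
have := mrp_markov (mrp i) i j t (past_avoid (X := X) (T := T) i (n := 0)).
by rewrite avoid0 !setTI start mule1.
Qed.

(** Monotone and bounded by 1, the kernel converges, so the [lim] in [embedded_mx] is a true limit
    and not a default value. *)
Lemma kernel_cvg i j : Q i j t @[t --> +oo] --> embedded_mx Q i j.
Proof.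
rewrite mxE; apply/cvg_ex; exists (sup (range (Q i j))).
apply: nondecreasing_cvgr; first exact: cumulative_is_nondecreasing.
exists 1 => _ [t _ <-]; rewrite -lee_fin kernel_initial.
by apply: probability_le1; exact: measurable_jump (mrp i) _ _ _ _.
Qed.

Lemma embedded_ge0 i j : 0 <= embedded_mx Q i j.
Proof.
rewrite mxE; apply: limr_ge.
  by apply/cvg_ex; exists (embedded_mx Q i j); exact: kernel_cvg.
apply: nearW => t.
by rewrite -lee_fin kernel_initial measure_ge0.
Qed.

Lemma embedded_evec : embedded_mx Q *m evec = evec.
Proof.
apply/colP => i; rewrite [RHS]mxE mxE; apply: EFin_inj.
rewrite -[RHS](start i) (measure_fibers _ (Y := X 1%N)); last 2 first.
- exact: (mrp_measurable_X (mrp i)).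
- exact: (mrp_measurable_X (mrp i)).
rewrite -sumEFin; apply: eq_bigr => k _; rewrite [evec _ _]mxE mulr1.
have := markov_step (mrp i) kernel_cvg i k (past_avoid (X := X) (T := T) i (n := 0)).
by rewrite avoid0 !setTI start mule1 => <-.
Qed.

Lemma mean_sojourn_ge0 i : 0 <= mean_sojourn Q i 0.
Proof.
rewrite mxE sumr_ge0// => k _; apply: fine_ge0.
by apply: integral_ge0 => t /=; rewrite in_itv/= andbT lee_fin.
Qed.

Hypothesis irr : irreducible_mx (embedded_mx Q).
Hypothesis Qfin : forall i j, (mean_time Q i j < +oo)%E.

Lemma mean_first_passage_system : exists v : 'I_m -> 'cV[R]_m,
  (forall j, v j = mean_sojourn Q + taboo (embedded_mx Q) j *m v j) /\
  (forall i j, mean_first_passage X T Pr i j = (v j i 0)%:E).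
Proof.
have /choice[v vP] j : exists v : 'cV[R]_m,
    v = mean_sojourn Q + taboo (embedded_mx Q) j *m v /\
    forall i, mean_first_passage X T Pr i j = (v i 0)%:E.
  have [v vE vc] := taboo_series_cvg embedded_ge0 embedded_evec irr j mean_sojourn_ge0.
  exists v; split => // i.
  by apply: (mean_first_passage_cvg (mrp i) kernel_cvg (start i)
    Qfin embedded_ge0 embedded_evec irr); exact: vc.
by exists v; split => [j|i j]; have [] := vP j.
Qed.

End EmbeddedChain.

Theorem theorem2 (R : realType) (d : measure_display) (Omega : measurableType d)
  (m : nat) (X : nat -> Omega -> 'I_m) (T : nat -> Omega -> R)
  (Q : 'I_m -> 'I_m -> cumulative R R) (Pr : 'I_m -> probability Omega R)
  (hMRP : forall i, is_MRP X T Q (Pr i))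
  (hstart : forall i, Pr i (X 0%N @^-1` [set i]) = 1%E)
  (P : 'M[R]_m) (hP : P = embedded_mx Q)
  (hirr : irreducible_mx P)
  (hfin : forall i j, (mean_time Q i j < +oo)%E)
  (mu : 'cV[R]_m) (hmu : mu = mean_sojourn Q)
  (pi : 'cV[R]_m) (hpiP : pi^T *m P = pi^T) (hpi1 : pi^T *m evec = 1%:M)
  (lambda : R) (hlambda : lambda = (pi^T *m mu) 0 0) (hlambda0 : 0 < lambda)
  (varpi : 'cV[R]_m) (hvarpi : varpi = smp_stationary pi mu) :
  (forall G : 'M[R]_m, is_ginverse (1%:M - P) G ->
    forall i, k2 X T Pr varpi i =
      (((1%:M + Emx *m diagpart G
         - lambda^-1 *: (Emx *m diagpart (G *m mu *m pi^T))) *m mu) i 0)%:E)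
  /\
  (1%:M - P + evec *m pi^T \in unitmx /\
   forall Z : 'M[R]_m, Z = invmx (1%:M - P + evec *m pi^T) ->
    forall i, k2 X T Pr varpi i =
      (((1%:M + Emx *m diagpart Z
         - lambda^-1 *: (Emx *m diagpart (Z *m mu *m pi^T))) *m mu) i 0)%:E)
  /\
  (forall Ash : 'M[R]_m, is_group_inverse (1%:M - P) Ash ->
    forall i, k2 X T Pr varpi i =
      (((1%:M + Emx *m diagpart Ash
         - lambda^-1 *: (Emx *m diagpart (Ash *m mu *m pi^T))) *m mu) i 0)%:E)
  /\
  (forall u : 'cV[R]_m, (u^T *m evec) 0 0 != 0 ->
    1%:M - P + mu *m u^T \in unitmx /\
    forall Gt : 'M[R]_m, Gt = invmx (1%:M - P + mu *m u^T) ->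
    forall i, k2 X T Pr varpi i =
      ((mu - ((u^T *m evec) 0 0)^-1 *: evec
        + ((evec^T *m diagpart Gt *m mu) 0 0) *: evec) i 0)%:E).
Proof.
subst lambda varpi mu.
have P_ge0 i j : 0 <= P i j by rewrite hP; exact: embedded_ge0.
have P_evec : P *m evec = evec by rewrite hP; exact: embedded_evec.
have [v [vE mfpE]] : exists v : 'I_m -> 'cV[R]_m,
    (forall j, v j = mean_sojourn Q + taboo P j *m v j) /\
    (forall i j, mean_first_passage X T Pr i j = (v j i 0)%:E).
  by move: hirr; rewrite hP => hirr; exact: mean_first_passage_system.
set mu := mean_sojourn Q in hlambda0 vE *.
have mixed G i : is_ginverse (1%:M - P) G ->
    k2 X T Pr (smp_stationary pi mu) i =
    (((1%:M + Emx *m diagpart G - ((pi^T *m mu) 0 0)^-1 *: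
       (Emx *m diagpart (G *m mu *m pi^T))) *m mu) i 0)%:E.
  move=> GG.
  rewrite -(mixed_passage_time P_ge0 P_evec hirr hpiP hlambda0 vE _ GG).
  by rewrite /k2 -sumEFin; apply: eq_bigr => j _; rewrite mfpE.
(* Used twice: with [b = e] and the row [pi^T] for [Z], where both nonvanishing conditions are
   [pie], and with [b = mu] for (d), where [pi^T mu] is positive. *)
have unitb := stationary_perturbation_unit P_ge0 P_evec hirr hpiP.
have ginvb := stationary_perturbation_ginverse P_ge0 P_evec hirr hpiP.
have pie : (pi^T *m evec) 0 0 != 0 by rewrite hpi1 mxE oner_eq0.
split; first by move=> G GG i; exact: mixed.
split.
  split; first exact: unitb.
  by move=> Z -> i; apply: mixed; exact: ginvb.
split; first by move=> A [AA _ _] i; exact: mixed.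
move=> u ue; have pimu : (pi^T *m mu) 0 0 != 0 by rewrite gt_eqF.
split; first exact: unitb.
move=> G GE i; have GG : is_ginverse (1%:M - P) G by rewrite GE; exact: ginvb.
have Gmu : G *m mu = ((u^T *m evec) 0 0)^-1 *: evec.
  by rewrite GE; exact: (perturbation_inv_mulmx P_ge0 P_evec hirr hpiP).
rewrite (mixed G)// Gmu; congr (_%:E).
(* As [G mu = c e], the diagonal of [G mu pi^T] is [c pi], and the correction term in (a) reduces to
   [c lambda / lambda = c]. *)
set c := (_^-1 in RHS).
have sum_pimu : (evec^T *m diagpart (c *: evec *m pi^T) *m mu) 0 0 =
    c * (pi^T *m mu) 0 0.
  rewrite mxE [X in _ * X]mxE mulr_sumr; apply: eq_bigr => j _.
  rewrite mxE (bigD1 j)//= big1 => [|l lj]; last first.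
    by rewrite !mxE (negPf lj) mulr0n mulr0.
  by rewrite !mxE big_ord1 !mxE eqxx mulr1n addr0 mul1r mulr1 mulrA.
have EmxD (D : 'M[R]_m) :
    (Emx *m diagpart D *m mu) i 0 = (evec^T *m diagpart D *m mu) 0 0.
  by rewrite /Emx -!mulmxA mxE big_ord1 mxE mul1r mulmxA.
rewrite !mulmxDl mulNmx mul1mx -scalemxAl.
transitivity (mu i 0 + (Emx *m diagpart G *m mu) i 0 - ((pi^T *m mu) 0 0)^-1 *
    (Emx *m diagpart (c *: evec *m pi^T) *m mu) i 0).
  by move: (_ *m _ *m mu) (_ *m _ *m mu) => x y; rewrite !mxE.
rewrite !EmxD sum_pimu mulrCA mulVf// mulr1.
by move: (_ *m _ *m mu) => x; rewrite !mxE !mulr1 addrAC.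
Qed.
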